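(* Let $G$ be a graph with no isolated vertex and $H$ any nontrivial graph with root $v\in V(H)$. The following statements are equivalent: (i) $\gamma_R(G\circ_v H)=\gamma(G)+n(G)(\gamma_R(H)-1)$; (ii) $\gamma_R(H-v)=\gamma_R(H)-1$ and there exists a Roman dominating function $g$ on $H$ of weight $\gamma_R(H)$ such that $g(v)=2$.
   Context: All graphs are finite and simple; a graph is nontrivial if it has at least two vertices; $n(G)=|V(G)|$. For a graph $G$ and a nontrivial graph $H$ with a root $v\in V(H)$, the rooted product graph $G\circ_v H$ is obtained by taking one copy of $G$ and $n(G)$ copies of $H$, and identifying the $i$-th vertex of $G$ with the vertex $v$ in the $i$-th copy of $H$, for each $i$. $H-v$ is $H$ with $v$ deleted. $\gamma(G)$ is the domination number (minimum size of a set $S$ such that every vertex is in $S$ or adjacent to a vertex of $S$). A Roman dominating function on a graph $X$ is $f:V(X)\to\{0,1,2\}$ such that every vertex with value $0$ has a neighbor with value $2$; its weight is $\sum_u f(u)$, and $\gamma_R(X)$ is the minimum weight of such $f$. *)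

(* Defs.v *)
From HB Require Import structures.
From mathcomp Require Import all_boot.

Set Implicit Arguments.
Unset Strict Implicit.
Unset Printing Implicit Defensive.

Record sgraph := SGraph {
  vertex :> finType;
  adj : rel vertex;
  adj_sym : symmetric adj;
  adj_irrefl : irreflexive adj
}.

Definition no_isolated_vertex (G : sgraph) : Prop :=
  forall x : G, exists y : G, adj x y.

Definition dominating (G : sgraph) (S : {set G}) : bool :=
  [forall x, (x \in S) || [exists y in S, adj x y]].

Definition domination_number (G : sgraph) : nat :=
  #|[arg min_(S < [set: G] | dominating S) #|S|]|.

Definition roman_dominating (G : sgraph) (f : {ffun G -> 'I_3}) : bool :=
  [forall x, (f x == 0 :> nat) ==> [exists y, adj x y && (f y == 2 :> nat)]].

Definition roman_weight (G : sgraph) (f : {ffun G -> 'I_3}) : nat :=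
  \sum_x f x.

(* The starting point of the minimisation is the constant function 2. *)
Definition roman_domination_number (G : sgraph) : nat :=
  roman_weight
    [arg min_(f < [ffun=> ord_max] | roman_dominating f) @roman_weight G f].

(* [arg min] is only meaningful when its starting point is admissible; the
   next lemmas check this and give the expected minimality properties. *)
Lemma dominating_setT (G : sgraph) : dominating [set: G].
Proof. by apply/forallP=> x; rewrite inE. Qed.

Lemma roman_dominating_cst2 (G : sgraph) :
  roman_dominating ([ffun=> ord_max] : {ffun G -> 'I_3}).
Proof. by apply/forallP=> x; rewrite ffunE. Qed.

Lemma domination_numberP (G : sgraph) :
  (exists2 S : {set G}, dominating S & #|S| = domination_number G) /\
  (forall S : {set G}, dominating S -> domination_number G <= #|S|).
Proof.
rewrite /domination_number.
case: arg_minnP => [|S domS minS]; first exact: dominating_setT.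
by split; first exists S.
Qed.

Lemma roman_domination_numberP (G : sgraph) :
  (exists2 f : {ffun G -> 'I_3}, roman_dominating f &
     roman_weight f = roman_domination_number G) /\
  (forall f : {ffun G -> 'I_3}, roman_dominating f ->
     roman_domination_number G <= roman_weight f).
Proof.
rewrite /roman_domination_number.
case: arg_minnP => [|f domf minf]; first exact: roman_dominating_cst2.
by split; first exists f.
Qed.

Section DeleteVertex.
Variables (H : sgraph) (v : H).

Definition del_adj : rel {x : H | x != v} := fun x y => adj (val x) (val y).

Lemma del_adj_sym : symmetric del_adj.
Proof. by move=> x y; apply: adj_sym. Qed.

Lemma del_adj_irrefl : irreflexive del_adj.
Proof. by move=> x; apply: adj_irrefl. Qed.

Definition del_vertex : sgraph := SGraph del_adj_sym del_adj_irrefl.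
End DeleteVertex.

(* The pair (g, h) is the vertex h of the copy of H attached at g; the root
   (g, v) of that copy is identified with the vertex g of G. *)
Section RootedProduct.
Variables (G H : sgraph) (v : H).

Definition rooted_adj : rel (G * H) := fun p q =>
  (p.1 == q.1) && adj p.2 q.2 || [&& p.2 == v, q.2 == v & adj p.1 q.1].

Lemma rooted_adj_sym : symmetric rooted_adj.
Proof.
move=> p q; rewrite /rooted_adj eq_sym (adj_sym p.2) (adj_sym p.1).
by rewrite [in LHS]andbCA.
Qed.

Lemma rooted_adj_irrefl : irreflexive rooted_adj.
Proof. by move=> p; rewrite /rooted_adj !adj_irrefl !andbF. Qed.

Definition rooted_product : sgraph := SGraph rooted_adj_sym rooted_adj_irrefl.
End RootedProduct.

(* Main.v *)
Require Import Defs.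
From mathcomp Require Import all_boot.

(** Let r be the Roman domination number of H. In a Roman dominating function
    f of the rooted product, the restriction of f to a copy of H can only fail
    to be Roman dominating at the root, and replacing the value 0 there by 1
    repairs it; so every copy has weight at least r - 1. A copy of weight less
    than r has its root dominated from a neighbouring root of value 2, whose own
    copy is then Roman dominating and has weight at least r. Hence the copies of
    weight at least r dominate G. If the total weight is gamma(G) + n(G)(r - 1),
    there are exactly gamma(G) < n(G) of them, all of weight r, and a copy of
    weight r - 1 together with a neighbour supplies both parts of (ii). *)

Lemma roman_dominatingP (G : sgraph) (f : {ffun G -> 'I_3}) :
  reflect (forall x, f x = 0 :> nat -> exists2 y, adj x y & f y = 2 :> nat)
          (roman_dominating f).
Proof.
apply: (iffP forallP) => [fP x fx0 | fP x].
  have /implyP := fP x; rewrite fx0 eqxx => /(_ isT) /existsP[y /andP[xy /eqP]].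
  by exists y.
apply/implyP => /eqP /fP[y xy fy2]; apply/existsP; exists y.
by rewrite xy fy2.
Qed.

Lemma leq_roman_domination_number (G : sgraph) (f : {ffun G -> 'I_3}) :
  roman_dominating f -> roman_domination_number G <= roman_weight f.
Proof. by case: (roman_domination_numberP G) => _; apply. Qed.

Lemma roman_weightD1 (G : sgraph) (f : {ffun G -> 'I_3}) (x : G) :
  roman_weight f = f x + \sum_(y | y != x) f y.
Proof. by rewrite /roman_weight (bigD1 x). Qed.

Lemma roman_domination_number_gt0 (G : sgraph) (x : G) :
  0 < roman_domination_number G.
Proof.
have [[f /roman_dominatingP fP <-] _] := roman_domination_numberP G.
have [/fP[y _ fy2]|fx] := posnP (f x).
  by rewrite (roman_weightD1 G f y) fy2.
by rewrite (roman_weightD1 G f x) ltn_addr.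
Qed.

(** The complement of any single vertex dominates, since that vertex has a neighbour. *)
Lemma domination_number_lt_card (G : sgraph) :
  0 < #|G| -> no_isolated_vertex G -> domination_number G < #|G|.
Proof.
move=> /card_gt0P[x _] noiso; have [_ minG] := domination_numberP G.
suff /minG : dominating (~: [set x]).
  by move=> /leq_ltn_trans; apply; rewrite -(cardsC [set x]) cards1.
apply/forallP => y; rewrite !inE; case: eqP => //= ->.
have [z xz] := noiso x; apply/existsP; exists z; rewrite !inE xz andbT.
by apply: contraTneq xz => ->; rewrite adj_irrefl.
Qed.

(** Only the root of a copy has neighbours outside it, so this weaker condition survives restriction
    to a copy. *)
Definition roman_dominating_off (H : sgraph) (v : H) (f : {ffun H -> 'I_3}) :=
  forall x, x != v -> f x = 0 :> nat -> exists2 y, adj x y & f y = 2 :> nat.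

Lemma roman_dominating_off_root (H : sgraph) (v : H) (f : {ffun H -> 'I_3}) :
  roman_dominating_off H v f -> 0 < f v -> roman_dominating f.
Proof.
move=> fP fv; apply/roman_dominatingP => x fx0; apply: fP => //.
by apply: contraTneq fv => <-; rewrite fx0.
Qed.

Lemma roman_dominating_off_weight (H : sgraph) (v : H) (f : {ffun H -> 'I_3}) :
  roman_dominating_off H v f ->
  roman_domination_number H <= (roman_weight f).+1.
Proof.
move=> fP; have [fv0|/(roman_dominating_off_root H v f fP)] := posnP (f v); last first.
  by move/leq_roman_domination_number/leq_trans; apply.
pose f1 : {ffun H -> 'I_3} := [ffun x => if x == v then inord 1 else f x].
have f1v : f1 v = 1 :> nat by rewrite ffunE eqxx inordK.
have f1E x : x != v -> f1 x = f x by rewrite ffunE => /negPf->.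
have -> : (roman_weight f).+1 = roman_weight f1.
  rewrite (roman_weightD1 H f v) (roman_weightD1 H f1 v) fv0 f1v; congr _.+1.
  by apply: eq_bigr => x /f1E->.
apply/leq_roman_domination_number/(roman_dominating_off_root H v); rewrite ?f1v //.
move=> x xv; rewrite f1E // => /(fP x xv)[y xy fy2]; exists y => //.
(* The neighbour [y] of value 2 is not [v], whose value was 0, so the change at [v] leaves it
   intact. *)
by rewrite f1E //; apply: contra_eq_neq fy2 => ->; rewrite fv0.
Qed.

(** A root of value 0 dominates no other vertex and carries no weight, so it can be deleted. *)
Lemma roman_domination_number_del_le (H : sgraph) (v : H) (f : {ffun H -> 'I_3}) :
  roman_dominating_off H v f -> f v = 0 :> nat ->
  roman_domination_number (del_vertex v) <= roman_weight f.
Proof.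
move=> fP fv0.
pose f' : {ffun del_vertex v -> 'I_3} := [ffun u => f (val u)].
have -> : roman_weight f = roman_weight f'.
  rewrite (roman_weightD1 H f v) fv0 (big_sub [pred x | x != v]).
  by apply: eq_bigr => u _; rewrite ffunE.
apply/leq_roman_domination_number/roman_dominatingP => x; rewrite ffunE.
case/(fP _ (valP x)) => y xy fy2.
have yv : y != v by apply: contra_eq_neq fy2 => ->; rewrite fv0.
by exists (Sub y yv : {x | x != v}); rewrite ?ffunE.
Qed.

(** An optimal function of [del_vertex v] is extended by 0 at the root, the one vertex where [insub]
    fails. *)
Lemma roman_dominating_off_del (H : sgraph) (v : H) :
  exists f : {ffun H -> 'I_3},
    [/\ roman_dominating_off H v f, f v = 0 :> nat
      & roman_weight f = roman_domination_number (del_vertex v)].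
Proof.
have [[f /roman_dominatingP fP fw] _] := roman_domination_numberP (del_vertex v).
pose g : {ffun H -> 'I_3} :=
  [ffun x => if insub x is Some u then f u else ord0].
have gE (u : del_vertex v) : g (val u) = f u by rewrite ffunE valK.
have gv0 : g v = 0 :> nat by rewrite ffunE insubF ?eqxx.
exists g; split=> //.
  move=> x xv; rewrite -[x](SubK {x | x != v} xv) gE => /fP[y xy fy2].
  by exists (val y); rewrite ?gE.
rewrite -fw (roman_weightD1 H g v) gv0 (big_sub [pred x | x != v]).
by apply: eq_bigr => u _; rewrite gE.
Qed.

Section RootedProduct.
Variables (G H : sgraph) (v : H).
Implicit Type f : {ffun rooted_product G v -> 'I_3}.

Definition copy_fun f (x : G) : {ffun H -> 'I_3} := [ffun h => f (x, h)].

Lemma roman_weight_copies f :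
  roman_weight f = \sum_x roman_weight (copy_fun f x).
Proof.
rewrite /roman_weight pair_bigA; apply: eq_bigr => -[x h] _ /=.
by rewrite ffunE.
Qed.

Lemma roman_dominating_off_copy f (x : G) :
  roman_dominating f -> roman_dominating_off H v (copy_fun f x).
Proof.
move=> /roman_dominatingP fP h hv; rewrite ffunE => /fP[[y k]].
rewrite /= /rooted_adj /= (negPf hv) orbF => /andP[/eqP<- hk] fk.
by exists k; rewrite ?ffunE.
Qed.

Lemma light_copy f (x : G) : roman_dominating f ->
    roman_weight (copy_fun f x) < roman_domination_number H ->
  copy_fun f x v = 0 :> nat /\
  exists y, [/\ adj x y, copy_fun f y v = 2 :> nat
              & roman_dominating (copy_fun f y)].
Proof.
move=> fR; have xP := roman_dominating_off_copy f x fR.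
rewrite ltnNge => light.
have notR : ~~ roman_dominating (copy_fun f x).
  by apply: contra light; apply: leq_roman_domination_number.
have xv0 : copy_fun f x v = 0 :> nat.
  apply/eqP; rewrite -leqn0 leqNgt; apply: contra notR.
  exact: roman_dominating_off_root.
split=> //; move/roman_dominatingP: (fR) => fP.
have [[y k] /orP[/andP[/= /eqP xy vk]|/and3P[/= _ /eqP-> xy]] fy2] :
    exists2 p, @rooted_adj G H v (x, v) p & f p = 2 :> nat.
- by apply: fP; move: xv0; rewrite ffunE.
(* A neighbour of value 2 inside the copy would make the restriction Roman dominating, so the root
   is dominated along an edge of [G]. *)
- case/negP: notR; apply/roman_dominatingP => h h0.
  have [->|hv] := eqVneq h v; last exact: xP.
  by exists k => //; rewrite ffunE xy.
exists y; have yv2 : copy_fun f y v = 2 :> nat by rewrite ffunE.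
split=> //; apply: roman_dominating_off_root (roman_dominating_off_copy f y fR) _.
by rewrite yv2.
Qed.

Definition heavy_copies f : {set G} :=
  [set x | roman_domination_number H <= roman_weight (copy_fun f x)].

Lemma heavy_copies_dominating f :
  roman_dominating f -> dominating (heavy_copies f).
Proof.
move=> fR; apply/forallP => x; rewrite inE; case: leqP => //=.
case/(light_copy f x fR) => _ [y [xy _ yR]]; apply/existsP; exists y.
by rewrite inE xy leq_roman_domination_number.
Qed.

Lemma copy_weight_ge f (x : G) : roman_dominating f ->
  (roman_domination_number H - 1) + (x \in heavy_copies f)
    <= roman_weight (copy_fun f x).
Proof.
move=> fR; have r_gt0 := roman_domination_number_gt0 H v.
have := roman_dominating_off_weight H v _ (roman_dominating_off_copy f x fR).
rewrite inE; case: (leqP (roman_domination_number H) (roman_weight _)) => /= [|_].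
  by rewrite subnK.
by rewrite addn0 leq_subLR add1n.
Qed.

Lemma sum_heavy (S : {set G}) (k : nat) :
  \sum_x (k + (x \in S)) = #|S| + #|G| * k.
Proof. by rewrite big_split /= sum_nat_const addnC -big_mkcond /= sum1_card. Qed.

Lemma roman_domination_number_rooted_ge :
  domination_number G + #|G| * (roman_domination_number H - 1)
    <= roman_domination_number (rooted_product G v).
Proof.
have [[f fR <-] _] := roman_domination_numberP (rooted_product G v).
have [_ minG] := domination_numberP G.
apply: leq_trans (leq_add (minG _ (heavy_copies_dominating f fR)) (leqnn _)) _.
rewrite -sum_heavy roman_weight_copies; apply: leq_sum => x _.
exact: copy_weight_ge.
Qed.

(** Use [g] on the copies over a minimum dominating set [S], and on the others an optimal function
    of [del_vertex v] extended by 0. The roots outside [S] are dominated by roots over [S], where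
    [g] has value 2. *)
Lemma roman_domination_number_rooted_le (g : {ffun H -> 'I_3}) :
    roman_dominating g -> roman_weight g = roman_domination_number H ->
    g v = 2 :> nat ->
    roman_domination_number (del_vertex v) = roman_domination_number H - 1 ->
  roman_domination_number (rooted_product G v)
    <= domination_number G + #|G| * (roman_domination_number H - 1).
Proof.
move=> /roman_dominatingP gP gw gv2 delE.
have [[S Sdom <-] _] := domination_numberP G.
have [h [hP hv0 hw]] := roman_dominating_off_del H v.
pose f : {ffun rooted_product G v -> 'I_3} :=
  [ffun p => if p.1 \in S then g p.2 else h p.2].
have copyE x : copy_fun f x = if x \in S then g else h.
  by apply/ffunP => k; rewrite !ffunE /=; case: ifP.
have <- : roman_weight f = #|S| + #|G| * (roman_domination_number H - 1).
  rewrite roman_weight_copies -sum_heavy; apply: eq_bigr => x _.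
  rewrite copyE; case: ifP => _; rewrite ?gw ?hw ?delE ?addn0 //.
  by rewrite subnK // (roman_domination_number_gt0 H v).
apply/leq_roman_domination_number/roman_dominatingP => -[x k].
rewrite ffunE /=; case: ifP => xS.
  case/gP => l kl gl2; exists (x, l); rewrite ?ffunE /= ?xS //.
  by rewrite /rooted_adj /= eqxx kl.
have [-> _|kv /(hP k kv)[l kl hl2]] := eqVneq k v.
  have /forallP/(_ x) := Sdom; rewrite xS => /existsP[y /andP[yS xy]].
  by exists (y, v); rewrite ?ffunE /= ?yS // /rooted_adj /= eqxx xy orbT.
exists (x, l); rewrite ?ffunE /= ?xS //.
by rewrite /rooted_adj /= eqxx kl.
Qed.

Lemma roman_domination_number_rooted_eq f :
    roman_dominating f ->
    roman_weight f =
      domination_number G + #|G| * (roman_domination_number H - 1) ->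
  #|heavy_copies f| = domination_number G /\
  forall x, roman_weight (copy_fun f x) =
            (roman_domination_number H - 1) + (x \in heavy_copies f).
Proof.
move=> fR fw; have [_ minG] := domination_numberP G.
have domS := minG _ (heavy_copies_dominating f fR).
(* The lower bounds on the copies add up to at least the total weight, so each of them is tight. *)
have geS x (_ : true) := @leqif_eq _ _ (copy_weight_ge f x fR).
have [] := leqif_sum geS.
rewrite sum_heavy -roman_weight_copies fw leq_add2r => leS.
have -> : #|heavy_copies f| = domination_number G.
  by apply/eqP; rewrite eqn_leq leS domS.
rewrite eqxx => /esym/forallP eqS; split=> // x.
by apply/esym/eqP/(implyP (eqS x)).
Qed.

End RootedProduct.

(* Graphs have at least one vertex by convention; for an empty G the
   equivalence fails. As H is nontrivial, roman_domination_number H >= 1, so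
   the subtractions are not truncated. *)
Theorem theorem3p6 (G H : sgraph) (v : H)
    (G_nonempty : 0 < #|G|)
    (G_noiso : no_isolated_vertex G)
    (H_nontrivial : 1 < #|H|) :
  roman_domination_number (rooted_product G v)
    = domination_number G + #|G| * (roman_domination_number H - 1)
  <->
  roman_domination_number (del_vertex v) = roman_domination_number H - 1
  /\ exists g : {ffun H -> 'I_3},
       [/\ roman_dominating g,
           roman_weight g = roman_domination_number H
         & g v = 2 :> nat].
Proof.
split=> [eqR | [delE [g [gR gw gv2]]]]; last first.
  apply/eqP; rewrite eqn_leq roman_domination_number_rooted_ge andbT.
  exact: (roman_domination_number_rooted_le G H v g).
have [[f fR fw] _] := roman_domination_numberP (rooted_product G v).
rewrite eqR in fw.
have [cardS wE] := roman_domination_number_rooted_eq G H v f fR fw.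
have [x xS] : exists x, x \notin heavy_copies G H v f.
  apply/existsP; rewrite -negb_forall; apply/negP => /forallP allS.
  have := domination_number_lt_card G G_nonempty G_noiso.
  by rewrite -cardS (eq_card (B := G)) ?ltnn // => x; rewrite allS.
have xlight : roman_weight (copy_fun G H v f x) < roman_domination_number H.
  by rewrite inE -ltnNge in xS.
have [xv0 [y [xy yv2 yR]]] := light_copy G H v f x fR xlight.
split; last first.
  exists (copy_fun G H v f y); split=> //; rewrite wE.
  (* The copy at [y] is Roman dominating, hence heavy, and tightness fixes its weight. *)
  rewrite inE leq_roman_domination_number //=.
  by rewrite subnK // (roman_domination_number_gt0 H v).
(* The upper bound comes from deleting the root of the light copy at [x], the lower bound from
   extending an optimal function of [del_vertex v] by 0. *)
apply/eqP; rewrite eqn_leq; apply/andP; split.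
  have := roman_domination_number_del_le H v _
            (roman_dominating_off_copy G H v f x fR) xv0.
  by rewrite wE (negPf xS) addn0.
have [h [hP _ <-]] := roman_dominating_off_del H v.
by rewrite leq_subLR add1n (roman_dominating_off_weight H v).
Qed.
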